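(* Let $p$ be an odd prime and let $G_1, G_2, \dots, G_{(p-1)/2}$ be 2-regular graphs of order $2p$. Then there is a 1-factor $I$ of $K_{2p}$ and a 2-factorisation $\{F_1, F_2, \dots, F_{p-1}\}$ of $K_{2p} - I$ such that $F_i \cong G_i$ for $i = 1, \dots, \frac{p-1}{2}$ and $F_i$ is a Hamilton cycle for $i = \frac{p+1}{2}, \dots, p-1$.
   Context: $K_n - I$ is $K_n$ with the edges of a perfect matching $I$ removed. A 2-factorisation of a graph is a decomposition of its edge set into edge-disjoint spanning 2-regular subgraphs. *)

(* Defs.v *)
From mathcomp Require Import all_boot.
Set Implicit Arguments.
Unset Strict Implicit.
Unset Printing Implicit Defensive.

Record sgraph (V : finType) := SGraph {
  adj : rel V;
  adj_sym : symmetric adj;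
  adj_irrefl : irreflexive adj
}.

Section Graphs.
Variable V : finType.
Implicit Types G H F : sgraph V.

Definition regular (k : nat) G : Prop :=
  forall x : V, #|[set y | adj G x y]| = k.

(* [F] and [H] share the vertex type [V], so [F] is automatically spanning. *)
Definition spanning_subgraph F H : Prop :=
  forall x y : V, adj F x y -> adj H x y.

Definition factor (k : nat) F H : Prop :=
  spanning_subgraph F H /\ regular k F.

Definition two_factorisation (J : finType) (F : J -> sgraph V) H : Prop :=
  [/\ forall j : J, factor 2 (F j) H,
      forall (i j : J) (x y : V), adj (F i) x y -> adj (F j) x y -> i = j
    & forall x y : V, adj H x y -> exists j : J, adj (F j) x y].

(* The edges of [F] are exactly those of the closed walk along [c], which
   visits every vertex once. *)
Definition hamilton_cycle F : Prop :=
  exists c : seq V,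
    [/\ uniq c, forall x : V, x \in c, 2 < size c
      & forall x y : V, adj F x y = (y == next c x) || (x == next c y)].

Lemma complete_sym : symmetric (fun x y : V => x != y).
Proof. by move=> x y; rewrite eq_sym. Qed.

Lemma complete_irrefl : irreflexive (fun x y : V => x != y).
Proof. by move=> x; rewrite eqxx. Qed.

Definition complete : sgraph V := SGraph complete_sym complete_irrefl.

Lemma delete_sym G I : symmetric (fun x y => adj G x y && ~~ adj I x y).
Proof. by move=> x y; rewrite (adj_sym G) (adj_sym I). Qed.

Lemma delete_irrefl G I : irreflexive (fun x y => adj G x y && ~~ adj I x y).
Proof. by move=> x; rewrite (adj_irrefl G). Qed.

Definition delete_edges G I : sgraph V :=
  SGraph (delete_sym G I) (delete_irrefl G I).

End Graphs.

Definition isomorphic (V W : finType) (F : sgraph V) (G : sgraph W) : Prop :=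
  exists f : V -> W,
    bijective f /\ forall x y : V, adj G (f x) (f y) = adj F x y.

Definition K (n : nat) : sgraph 'I_n := complete 'I_n.

(* Main.v *)
Require Import Defs.
From mathcomp Require Import all_boot all_algebra.
From mathcomp Require Import zify ring.
(* The circulant graph Circ(2p, {1, 2}) splits into any prescribed 2-regular
   graph G of order 2p and a Hamilton cycle.  Cut 0, ..., 2p - 1 into
   consecutive intervals whose lengths are the cycle lengths of G, and on each
   interval [a, b] take the cycle with edges {a, a + 1}, {b - 1, b} and
   {i, i + 2} for a <= i <= b - 2.  What remains is the cycle obtained from
   0, 1, ..., 2p - 1 by exchanging b and b + 1 at every interval end b.
   As p is an odd prime, the units u = 1, 3, ..., p - 2 of Z/2p give disjoint
   sets {u, -u, 2u, -2u} that cover everything but 0 and p, so the copies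
   Circ(2p, {u, 2u}) of Circ(2p, {1, 2}) decompose K_2p minus the 1-factor of
   the pairs {x, x + p}. *)

Set Implicit Arguments.
Unset Strict Implicit.
Unset Printing Implicit Defensive.

(** * Zigzag listings of the cycles of a 2-regular graph *)

Section TwoRegular.
Variables (V : finType) (G : sgraph V).
Hypothesis G2 : regular 2 G.

Lemma regular2_other x a : adj G x a ->
  exists2 b, b != a & forall y, adj G x y = (y == a) || (y == b).
Proof.
move=> xa; have /eqP/cards2P [u [v [uv E]]] := G2 x.
have E' y : adj G x y = (y == u) || (y == v).
  by move/setP/(_ y): E; rewrite !inE.
move: xa; rewrite E' => /orP[]/eqP->.
  by exists v => //; rewrite eq_sym.
by exists u => // y; rewrite E' orbC.
Qed.

Lemma regular2_neighbours x a b : adj G x a -> adj G x b -> a != b ->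
  forall y, adj G x y = (y == a) || (y == b).
Proof.
move=> xa xb ab y; have [c ca E] := regular2_other xa.
rewrite E; move: xb; rewrite E eq_sym (negPf ab) /=.
by move=> /eqP->.
Qed.

(* Positions of the two neighbours of the [i]-th vertex when a cycle of length
   [k] is listed in the order v0, v1, ... with edges v0 v1, v_i v_(i+2) and
   v_(k-2) v_(k-1). *)
Definition zigzag_prev i := if i is j.+2 then j else nat_of_bool (i == 0).

Definition zigzag_next k i :=
  if i == k - 1 then k - 2 else if i == k - 2 then k - 1 else i + 2.

Variable x0 : V.

(** A path ..., b2, b0, b1, b3, ... grown alternately on both sides; its open ends are the last two
    entries. *)
Definition zigzag (b : seq V) :=
  [/\ uniq b, 2 <= size b, adj G (nth x0 b 0) (nth x0 b 1)
    & forall i, i.+2 < size b -> adj G (nth x0 b i) (nth x0 b i.+2)].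

Lemma zigzag_adj_prev b i : zigzag b -> i < size b ->
  adj G (nth x0 b i) (nth x0 b (zigzag_prev i)).
Proof.
move=> [_ _ b01 bS]; case: i => [|[|i]] //= lt_i; rewrite adj_sym //.
exact: bS.
Qed.

Lemma zigzag_neighbours b i : zigzag b -> i.+2 < size b -> forall y,
  adj G (nth x0 b i) y =
    (y == nth x0 b (zigzag_prev i)) || (y == nth x0 b i.+2).
Proof.
move=> zb lt_i; have [ub _ _ bS] := zb.
apply: regular2_neighbours; [apply: zigzag_adj_prev => //; lia|exact: bS|].
rewrite nth_uniq //; case: (i) lt_i => [|[|j]] /=; lia.
Qed.

(** An open path is lengthened at position [size b - 2] by the other neighbour of that vertex, which
    is not yet listed; finiteness of [V] forces the path to close up. *)
Lemma zigzag_complete (A : {pred V}) (b : seq V) :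
  (forall x y, adj G x y -> x \in A -> y \in A) ->
  zigzag b -> {subset b <= A} ->
  exists c : seq V, [/\ zigzag c, {subset c <= A}, 2 < size c
    & adj G (nth x0 c (size c - 2)) (nth x0 c (size c - 1))].
Proof.
move=> clA; have [m] := ubnP (#|V| - size b).
elim: m b => // m IHm b lt_m zb bA; have [ub b2 b01 bS] := zb.
(* With two entries the last edge is the first one, so a closed path needs [2 < size b]. *)
have [/andP[b3 last_adj]|open_b] := boolP ((2 < size b)
    && adj G (nth x0 b (size b - 2)) (nth x0 b (size b - 1))).
  by exists b.
have lt2 : size b - 2 < size b by lia.
have [w wP wadj] := regular2_other (zigzag_adj_prev zb lt2).
have vw : adj G (nth x0 b (size b - 2)) w by rewrite wadj eqxx orbT.
have wA : w \in A by apply: clA vw _; apply: bA; apply: mem_nth.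
(* Before the last two positions both neighbours are already listed at known places. The last entry
   is excluded because the path is open or, with only two entries, because it is the neighbour
   already used. *)
have wb : w \notin b.
  apply/negP => /(nthP x0) [j + wE]; rewrite -[size b]/(@size V b) => lt_j.
  move: vw wP; rewrite -wE => vw wP.
  have [lt_j2|] := ltnP j.+2 (size b).
    have lt_p : zigzag_prev j < size b by case: (j) lt_j2 => [|[|i]] /=; lia.
    move: vw; rewrite adj_sym (zigzag_neighbours zb lt_j2) !nth_uniq //.
    case/orP => /eqP kE; last by rewrite kE /= eqxx in wP.
    case: j lt_j2 kE wP {lt_j wE lt_p} => [|[|i]] /= lt_j2 kE wP; try lia.
    by rewrite kE /= eqxx in wP.
  move=> ge_j; have [jE|jE] : j = size b - 2 \/ j = size b - 1 by lia.
    by rewrite -jE adj_irrefl in vw.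
  move: open_b; rewrite -jE vw andbT => b3.
  have kE : size b - 2 = 0 by lia.
  by move: wP; rewrite kE jE /= (_ : size b - 1 = 1) ?eqxx //; lia.
apply: (IHm (rcons b w)).
- rewrite size_rcons; suff: size b < #|V| by lia.
  have: uniq (rcons b w) by rewrite rcons_uniq wb ub.
  move/card_uniqP; rewrite size_rcons -[size b]/(@size V b) => <-.
  exact: max_card.
- split; rewrite ?size_rcons ?rcons_uniq ?wb //; first lia.
    by rewrite !nth_rcons b2 (ltnW b2).
  move=> i lt_i; rewrite !nth_rcons (_ : i < size b); last lia.
  have [/bS//|ge_i] := ltnP i.+2 (size b).
  have kE : i.+2 = size b by lia.
  by rewrite kE eqxx (_ : i = size b - 2) //; lia.
- by move=> y; rewrite mem_rcons inE => /orP[/eqP->|/bA].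
Qed.

Lemma zigzag_block (A : {pred V}) x1 :
  (forall x y, adj G x y -> x \in A -> y \in A) -> x1 \in A ->
  exists b : seq V, [/\ uniq b, {subset b <= A}, 2 < size b &
    forall j y, j < size b -> adj G (nth x0 b j) y =
      (y == nth x0 b (zigzag_prev j))
      || (y == nth x0 b (zigzag_next (size b) j))].
Proof.
move=> clA x1A; have /eqP/cards2P [u [v [uv E]]] := G2 x1.
have x1u : adj G x1 u by move/setP/(_ u): E; rewrite !inE eqxx.
have zb : zigzag [:: x1; u].
  split=> //=; rewrite inE andbT; apply/eqP => x1E.
  by move: x1u; rewrite -x1E adj_irrefl.
have [|b [zc cA c3 last_adj]] := zigzag_complete clA zb.
  by move=> y; rewrite !inE => /orP[]/eqP-> //; apply: clA x1u _.
have [ub _ _ bS] := zc; exists b; split=> // j y lt_j.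
apply: regular2_neighbours; first exact: zigzag_adj_prev.
  rewrite /zigzag_next; case: eqP => [->|j1]; first by rewrite adj_sym.
  case: eqP => [->//|j2]; rewrite addn2; apply: bS; lia.
have lt_p : zigzag_prev j < size b by case: (j) lt_j => [|[|i]] /=; lia.
have lt_n : zigzag_next (size b) j < size b.
  by rewrite /zigzag_next; do 2?case: eqP; lia.
rewrite nth_uniq // /zigzag_next {lt_p lt_n}.
apply/eqP; case: j lt_j => [|[|i]] lt_j; (case: ifP => ?; [|case: ifP => ?]);
  rewrite /=; lia.
Qed.

(* A vertex list cut into consecutive blocks: [e i] says that position [i] is
   the last one of its block. *)
Definition mark_prev (e : pred nat) i :=
  if (i == 0) || e i.-1 then i.+1
  else if (i == 1) || e (i - 2) then i.-1 else i - 2.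

Definition mark_next (e : pred nat) i :=
  if e i then i.-1 else if e i.+1 then i.+1 else i.+2.

(** [s] may cover only some of the cycles, so that it can grow block by block. Ends are at least
    three apart because a cycle has length at least 3. *)
Definition zigzag_blocks (s : seq V) (e : pred nat) :=
  [/\ uniq s, size s = 0 \/ e (size s).-1,
      forall i, e i -> [&& 2 <= i, i < size s, ~~ e i.-1 & ~~ e (i - 2)]
    & forall i y, i < size s -> adj G (nth x0 s i) y =
        (y == nth x0 s (mark_prev e i)) || (y == nth x0 s (mark_next e i))].

(** The last position is an end, so [mark_next] never runs past it; a block start is never the last
    position because blocks have at least three entries. *)
Lemma mark_lt s e i : zigzag_blocks s e -> i < size s ->
  mark_prev e i < size s /\ mark_next e i < size s.
Proof.
move=> [_ s0 eP _] lt_i; have {s0} es : e (size s).-1 by case: s0 => //; lia.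
have [/and4P[s2 _ s1 s2']] := (eP _ es).
rewrite /mark_prev /mark_next.
have E1 : e i -> i < size s by case/eP/and4P.
have E2 : e i.+1 -> i.+1 < size s by case/eP/and4P.
have N1 : i = (size s).-1 -> e i by move->.
have N2 : i.+1 = (size s).-1 -> e i.+1 by move->.
split; last first.
  case: (e i) E1 N1 => E1 N1; first lia.
  case: (e i.+1) E2 N2 => E2 N2; first lia.
  lia.
case: ifP => [/orP[/eqP i0|ei]|_]; [lia| |case: ifP => _; lia].
have [//|ge_i] := ltnP i.+1 (size s).
have iE : i = (size s).-1 by lia.
by move: s1; rewrite -iE ei.
Qed.

(** Both neighbours of a listed vertex are listed by [mark_lt]; the complement of [s] is thus a
    union of cycles, from which the next block is taken. *)
Lemma zigzag_blocks_closed s e x y : zigzag_blocks s e ->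
  adj G x y -> x \notin s -> y \notin s.
Proof.
move=> zs xy; apply: contra => /(nthP x0) [i + yE].
rewrite -[size s]/(@size V s) => lt_i.
have [lt_p lt_n] := mark_lt zs lt_i.
have [_ _ _ /(_ i x lt_i)] := zs; rewrite yE adj_sym xy.
by case/esym/orP => /eqP->; apply: mem_nth.
Qed.

Lemma zigzag_blocks_cat s e (b : seq V) : zigzag_blocks s e ->
  uniq b -> {subset b <= [predC s]} -> 2 < size b ->
  (forall j y, j < size b -> adj G (nth x0 b j) y =
    (y == nth x0 b (zigzag_prev j))
    || (y == nth x0 b (zigzag_next (size b) j))) ->
  zigzag_blocks (s ++ b) (fun i => e i || (i == size s + size b - 1)).
Proof.
move=> zs ub bs b3 badj; have [us s0 eP sadj] := zs.
set k := size s in s0 eP sadj *; set l := size b in b3 badj *.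
have e_lt i : e i -> i < k by case/eP/and4P.
have e_ge i : k <= i -> e i = false.
  by move=> ki; apply/negP => /e_lt; lia.
split.
- rewrite cat_uniq us ub andbT /=; apply/hasPn => y /bs.
  by rewrite inE.
- by right; rewrite size_cat; apply/orP; right; apply/eqP; rewrite -/k -/l; lia.
- move=> i /orP[ei|/eqP iE]; rewrite size_cat -/k -/l.
    have /and4P[i2 ik /negPf-> /negPf->] := eP _ ei.
    by rewrite /=; lia.
  by rewrite !e_ge /=; lia.
move=> i y; rewrite size_cat -/k -/l => lt_i.
have [lt_ik|le_ki] := ltnP i k.
  have [lt_p lt_n] := mark_lt zs lt_ik.
  set e' := (fun _ => _ || _).
  (* The bound includes [k], since [mark_next] at the last old position reads the mark at [k]; the
     new mark lies beyond it because [2 < l]. *)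
  have e'E j : j <= k -> e' j = e j.
    by move=> jk; rewrite /e' (_ : _ == _ = false) ?orbF //; lia.
  have -> : mark_prev e' i = mark_prev e i by rewrite /mark_prev !e'E //; lia.
  have -> : mark_next e' i = mark_next e i by rewrite /mark_next !e'E //; lia.
  by rewrite !nth_cat -/k lt_ik lt_p lt_n sadj.
have [j iE] : exists j, i = k + j by exists (i - k); lia.
have lt_j : j < l by lia.
have nthE m : nth x0 (s ++ b) (k + m) = nth x0 b m.
  by rewrite nth_cat -/k ifF; [congr (nth _ _ _); lia|lia].
(* Position [k] starts a block: either [s] is empty or [k.-1] is an end. *)
have pE : mark_prev (fun i => e i || (i == k + l - 1)) i = k + zigzag_prev j.
  rewrite /mark_prev; case: j iE lt_j => [|[|j]] iE lt_j /=.
  - rewrite ifT; first lia.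
    case: s0 => [k0|ek]; first by rewrite iE k0.
    by rewrite iE addn0 ek orbT.
  - rewrite e_ge; last lia.
    rewrite ifF; last lia.
    rewrite ifT; first lia.
    case: s0 => [k0|ek]; first by rewrite iE k0.
    by rewrite iE (_ : k + 1 - 2 = k.-1) ?ek ?orbT //; lia.
  - rewrite !e_ge; try lia.
    rewrite ifF; last lia.
    rewrite ifF; lia.
have nE : mark_next (fun i => e i || (i == k + l - 1)) i = k + zigzag_next l j.
  rewrite /mark_next /zigzag_next !e_ge; try lia.
  rewrite /=; (case: ifP => ?; [|case: ifP => ?]);
    (case: ifP => ?; [|case: ifP => ?]); lia.
by rewrite pE nE iE !nthE badj.
Qed.

Lemma zigzag_blocks_exists :
  exists s e, zigzag_blocks s e /\ forall x, x \in s.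
Proof.
suff step m s e : #|V| - size s < m -> zigzag_blocks s e ->
    exists s e, zigzag_blocks s e /\ forall x, x \in s.
  by apply: (step #|V|.+1 [::] pred0); [rewrite /=; lia|split=> //; left].
elim: m s e => // m IHm s e lt_m zs.
have [full|] := boolP [forall x, x \in s].
  by exists s, e; split=> //; apply/forallP.
rewrite negb_forall => /existsP [x1 x1s].
have clA x y : adj G x y -> x \in [predC s] -> y \in [predC s].
  by rewrite !inE; apply: zigzag_blocks_closed zs.
have [b [ub bs b3 badj]] := zigzag_block clA x1s.
have zc := zigzag_blocks_cat zs ub bs b3 badj.
apply: (IHm _ _ _ zc); have [/card_uniqP] := zc.
rewrite size_cat => uE _ _ _; have := max_card (mem (s ++ b)).
rewrite uE -[size s]/(@size V s) -[size b]/(@size V b); lia.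
Qed.

End TwoRegular.

(** * The circulant graph with steps 1 and 2, split into interval cycles and a Hamilton cycle *)

Import GRing.Theory.
Local Open Scope ring_scope.

Section Circulant.
Variable m : nat.
Implicit Types x y : 'I_m.+2.

Lemma val_natr k : (k%:R : 'I_m.+2) = (k %% m.+2)%N :> nat.
Proof. by rewrite Zp_nat. Qed.

Lemma natr_neq0 k : (0 < k < m.+2)%N -> (k%:R == 0 :> 'I_m.+2) = false.
Proof.
move=> /andP[k0 km]; apply/eqP => /(congr1 val) /=.
by rewrite val_natr modn_small //; lia.
Qed.

Lemma val_addr1 x : x + 1 = (if x == m.+1 :> nat then 0 else x.+1)%N :> nat.
Proof.
have -> : x + 1 = (x.+1 %% m.+2)%N :> nat.
  by rewrite /= (@modn_small 1) // addn1.
case: ifP => [/eqP->|/eqP]; first by rewrite modnn.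
by have := ltn_ord x => *; rewrite modn_small //; lia.
Qed.

Lemma val_subr1 x : x - 1 = (if x == 0 :> nat then m.+1 else x.-1)%N :> nat.
Proof.
have := val_addr1 (x - 1); rewrite subrK.
have := ltn_ord (x - 1); have := ltn_ord x.
move: (x - 1) => z; case: ifP => ?; case: ifP => ?; lia.
Qed.

(** Adjacency in Circ(m + 2, {1, 2}). *)
Definition near x y := y \in [:: x + 1; x - 1; x + 1 + 1; x - 1 - 1].

Definition spaced (e : pred 'I_m.+2) :=
  forall x, e x -> ~~ e (x + 1) && ~~ e (x + 1 + 1).

(** Cyclic forms of [mark_prev] and [mark_next]: the tests at positions 0 and 1 disappear once the
    last position is an end. *)
Definition cyclic_prev (e : pred 'I_m.+2) x :=
  if e (x - 1) then x + 1 else if e (x - 1 - 1) then x - 1 else x - 1 - 1.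

Definition cyclic_next (e : pred 'I_m.+2) x :=
  if e x then x - 1 else if e (x + 1) then x + 1 else x + 1 + 1.

Definition swap (e : pred 'I_m.+2) x :=
  if e x then x + 1 else if e (x - 1) then x - 1 else x.

Definition cycle_adj x y := (y == x + 1) || (x == y + 1).

Variable e : pred 'I_m.+2.
Hypothesis eP : spaced e.

Lemma spacedS x : e x -> e (x + 1) = false.
Proof. by case/eP/andP => /negPf. Qed.

Lemma spacedSS x : e x -> e (x + 1 + 1) = false.
Proof. by case/eP/andP => _ /negPf. Qed.

Lemma spacedP x : e x -> e (x - 1) = false.
Proof. by move=> ex; apply/negP => /spacedS; rewrite subrK ex. Qed.

Lemma spacedPP x : e x -> e (x - 1 - 1) = false.
Proof. by move=> ex; apply/negP => /spacedSS; rewrite !subrK ex. Qed.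

Lemma swapK : involutive (swap e).
Proof.
move=> x; rewrite {2}/swap; case ex: (e x).
  by rewrite /swap (spacedS ex) addrK ex.
case ex1: (e (x - 1)); first by rewrite /swap ex1 subrK.
by rewrite /swap ex ex1.
Qed.

Lemma swap_succ x : swap e (swap e x + 1) =
  if e x then x + 1 + 1 else if e (x - 1) then x - 1
  else if e (x + 1) then x + 1 + 1 else x + 1.
Proof.
rewrite {2}/swap; case ex: (e x).
  by rewrite /swap (spacedSS ex) addrK (spacedS ex).
case ex1: (e (x - 1)); first by rewrite subrK /swap ex ex1.
by rewrite /swap addrK ex.
Qed.

Lemma swap_pred x : swap e (swap e x - 1) =
  if e x then x + 1 else if e (x - 1) then x - 1 - 1
  else if e (x - 1 - 1) then x - 1 - 1 else x - 1.
Proof.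
rewrite {2}/swap; case ex: (e x); first by rewrite addrK /swap ex.
case ex1: (e (x - 1)); last by rewrite /swap ex1.
by rewrite /swap (spacedP ex1) (spacedPP ex1).
Qed.

(** As [swap e] is an involution, neighbours in the exchanged cycle are found by exchanging,
    stepping by 1 or -1 and exchanging back. *)
Lemma cycle_adj_swap x y : cycle_adj (swap e x) (swap e y) =
  (y == swap e (swap e x + 1)) || (y == swap e (swap e x - 1)).
Proof.
rewrite /cycle_adj -!(can_eq swapK y) !swapK.
by congr (_ || _); rewrite [RHS]eq_sym subr_eq.
Qed.

Hypothesis m4 : (4 <= m)%N.

(** The differences are 1, 2, 3 or 4 up to sign, hence nonzero modulo [m.+2], which is at least
    6. *)
Lemma near_uniq x : uniq [:: x + 1; x - 1; x + 1 + 1; x - 1 - 1].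
Proof.
have N k (a b : 'I_m.+2) : (0 < k < 6)%N -> a - b = k%:R -> (a == b) = false.
  by move=> k6 ab; rewrite -subr_eq0 ab natr_neq0 //; lia.
rewrite /= !inE (N 2 (x + 1) (x - 1)); [|lia|ring].
rewrite (eq_sym (x + 1)) (N 1 (x + 1 + 1) (x + 1)); [|lia|ring].
rewrite (N 3 (x + 1) (x - 1 - 1)); [|lia|ring].
rewrite (eq_sym (x - 1)) (N 3 (x + 1 + 1) (x - 1)); [|lia|ring].
rewrite (N 1 (x - 1) (x - 1 - 1)); [|lia|ring].
by rewrite (N 4 (x + 1 + 1) (x - 1 - 1)); [|lia|ring].
Qed.

(** The pointwise form of the splitting: two neighbours from the exchanged cycle and two from the
    interval cycles make up the four circulant neighbours. The cases are the possible marks at x -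
    2, x - 1, x and x + 1. *)
Lemma perm_swap_cyclic x :
  perm_eq [:: swap e (swap e x + 1); swap e (swap e x - 1);
              cyclic_prev e x; cyclic_next e x]
          [:: x + 1; x - 1; x + 1 + 1; x - 1 - 1].
Proof.
(* Counting an arbitrary predicate [q] turns each case into an identity between sums of booleans. *)
apply/permP => q; rewrite swap_succ swap_pred /cyclic_prev /cyclic_next.
have := (@spacedP x, @spacedPP x); case: (e x) => [[-> // -> //]|_] /=.
  lia.
have := @spacedSS (x - 1); rewrite subrK.
case: (e (x - 1)) => [-> //|_] /=; first lia.
by case: (e (x + 1)); case: (e (x - 1 - 1)) => /=; lia.
Qed.

Lemma cycle_adj_swap_near x y : cycle_adj (swap e x) (swap e y) =
  near x y && ~~ ((y == cyclic_prev e x) || (y == cyclic_next e x)).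
Proof.
have := near_uniq x; rewrite cycle_adj_swap /near.
rewrite -(perm_uniq (perm_swap_cyclic x)) -(perm_mem (perm_swap_cyclic x)).
move: (swap e (_ + 1)) (swap e (_ - 1)) (cyclic_prev e x) (cyclic_next e x).
move=> a b c d.
rewrite /= !inE !negb_or andbT.
case/and3P=> /and3P[_ ac ad] /andP[bc bd] _.
case: (eqVneq y a) => [->|_] /=; first by rewrite ac ad.
case: (eqVneq y b) => [->|_] /=; first by rewrite bc bd.
by rewrite -negb_or andbN.
Qed.

Lemma cyclic_near x y : (y == cyclic_prev e x) || (y == cyclic_next e x) ->
  near x y.
Proof.
rewrite /near -(perm_mem (perm_swap_cyclic x)) !inE => /orP[] ->;
  by rewrite !orbT.
Qed.

End Circulant.

(** * Transport of a 2-regular graph to the residues modulo [m.+2] *)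

Section Decomposition.
Variables (m : nat) (V : finType) (G : sgraph V).
Hypotheses (V_card : #|V| = m.+2) (G2 : regular 2 G).

Lemma two_regular_cyclic_order :
  exists h : 'I_m.+2 -> V, exists e : pred 'I_m.+2,
  [/\ bijective h, spaced e & forall x y,
     adj G (h x) (h y) = (y == cyclic_prev e x) || (y == cyclic_next e x)].
Proof.
have /card_gt0P [x0 _] : (0 < #|V|)%N by rewrite V_card.
have [s [e [zs s_full]]] := zigzag_blocks_exists G2 x0.
have [us s0 eP sadj] := zs.
have sz : size s = m.+2.
  by rewrite -V_card -(card_uniqP us); apply: eq_card => x; rewrite s_full.
(* Since the last position is an end, 0 starts an interval in the cyclic sense, and the linear and
   cyclic neighbour formulas agree across the wrap. *)
have em : e m.+1 by case: s0; rewrite sz.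
have {s0} e2 i : e i -> (1 < i < m.+2)%N.
  by case/eP/and4P => *; rewrite -sz; apply/andP.
have e1 i : e i -> e i.-1 = false by case/eP/and4P => _ _ /negPf.
have e1' i : e i.+1 -> e i = false by move/e1.
have e2' i : e i.+2 -> e i = false.
  by case/eP/and4P => _ _ _ /negPf; rewrite subn2.
have e0 : e 0%N = false by apply/negP => /e2.
have e01 : e 1%N = false by apply/negP => /e2.
exists (fun x : 'I_m.+2 => nth x0 s x), (fun x : 'I_m.+2 => e x).
have h_inj : injective (fun x : 'I_m.+2 => nth x0 s x).
  by move=> x y /eqP; rewrite nth_uniq ?sz // => /eqP/val_inj.
split.
- by apply: inj_card_bij h_inj _; rewrite V_card card_ord.
- move=> x ex; rewrite !val_addr1.
  case: (ifP (x == m.+1 :> nat)) => [_|xm] /=; first by rewrite e0 e01.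
  have -> : e x.+1 = false by apply/negP => /e1'; rewrite ex.
  rewrite /=.
  case: ifP => [_|_]; first by rewrite e0.
  by apply/negP => /e2'; rewrite ex.
move=> x y; rewrite sadj ?sz //.
have -> : mark_prev e x = cyclic_prev (fun x : 'I_m.+2 => e x) x.
  rewrite /mark_prev /cyclic_prev !val_subr1.
  have [x_0|x_neq0] := eqVneq (x : nat) 0%N.
    by rewrite em val_addr1 x_0.
  rewrite /=; case ex1 : (e x.-1).
    rewrite val_addr1 ifF //; apply/eqP => xm.
    by move: (e1 _ em); rewrite -xm ex1.
  have [x_1|x_neq1] := eqVneq (x : nat) 1%N.
    by rewrite x_1 /= em val_subr1 x_1.
  have -> : (x.-1 == 0)%N = false by lia.
  rewrite subn2 /=; case: (e x.-2); rewrite !val_subr1 (negPf x_neq0) //.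
  by rewrite ifF //; lia.
have -> : mark_next e x = cyclic_next (fun x : 'I_m.+2 => e x) x.
  rewrite /mark_next /cyclic_next.
  case ex: (e x).
    by rewrite val_subr1 ifF //; apply/negP => /eqP x_0; rewrite x_0 e0 in ex.
  have xm : (x == m.+1 :> nat) = false.
    by apply/negP => /eqP xm; rewrite xm em in ex.
  rewrite val_addr1 xm; case ex1: (e x.+1); first by rewrite val_addr1 xm.
  rewrite !val_addr1 xm ifF //; apply/negP => /eqP xm1.
  by rewrite xm1 em in ex1.
by rewrite !nth_uniq ?sz.
Qed.

(** The connection set of Circ(m + 2, {u, 2u}). *)
Definition jump (u d : 'I_m.+2) := d \in [:: u; - u; u + u; - (u + u)].

(** Multiplication by a unit [u] carries Circ(m + 2, {1, 2}) onto Circ(m + 2, {u, 2u}). *)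
Lemma near_jump (u x y : 'I_m.+2) : u \is a GRing.unit ->
  near (u^-1 * x) (u^-1 * y) = jump u (y - x).
Proof.
move=> uU; rewrite /near /jump !inE.
have E a : (u^-1 * y == u^-1 * x + a) = (y - x == u * a).
  rewrite -(inj_eq (mulrI uU)) mulrDr !mulVKr //.
  by rewrite [RHS]subr_eq [X in _ = (_ == X)]addrC.
rewrite -[u^-1 * x + 1 + 1]addrA -[u^-1 * x - 1 - 1]addrA !E.
by rewrite mulrN1 -opprD mulrN mulrDr mulr1.
Qed.

End Decomposition.

Lemma isomorphic_regular (V W : finType) (F : sgraph V) (G : sgraph W) k :
  isomorphic F G -> regular k G -> regular k F.
Proof.
move=> [f [bf fE]] Gk x; rewrite -(Gk (f x)) -(on_card_preimset (f := f)).
  by apply: eq_card => y; rewrite !inE fE.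
by case: bf => g fK gK; exists g => y _.
Qed.

Lemma next_enum_ord m (i : 'I_m.+2) : next (enum 'I_m.+2) i = i + 1.
Proof.
apply: ord_inj; rewrite val_addr1 next_nth mem_enum inE index_enum_ord.
have := size_enum_ord m.+2; have := @nth_enum_ord m.+2 i.
case: (enum _) => //= y p pE [sp]; case: ifP => [/eqP iE|/eqP iE].
  (* At the last index [next] returns the default of [nth], which is the head of the list, of value
     0. *)
  by rewrite nth_default ?sp ?iE // -(pE 0%N).
have lt_i : (i.+1 < m.+2)%N by have := ltn_ord i; lia.
by rewrite -[RHS](pE i.+1) //=; apply/congr1/set_nth_default; rewrite sp; lia.
Qed.

(** * Relabelled cycles, and the pair of factors attached to a unit *)

Section CycleGraph.
Variables (m : nat) (W : finType) (H : sgraph W).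
Variables (f : 'I_m.+2 -> W) (g : W -> 'I_m.+2).
Hypotheses (m_gt0 : (0 < m)%N) (fK : cancel f g) (gK : cancel g f).
Hypothesis H_adj : forall x y, adj H x y = cycle_adj (g x) (g y).

Lemma cycle_adj_hamilton : hamilton_cycle H.
Proof.
exists (map f (enum 'I_m.+2)).
have f_inj := can_inj fK.
split.
- by rewrite map_inj_uniq // enum_uniq.
- by move=> x; rewrite -(gK x) map_f // mem_enum.
- by rewrite size_map size_enum_ord.
have nE x : next (map f (enum 'I_m.+2)) x = f (g x + 1).
  by rewrite -{1}(gK x) next_map ?enum_uniq // next_enum_ord.
by move=> x y; rewrite H_adj !nE /cycle_adj !(can2_eq gK fK).
Qed.

Lemma cycle_adj_regular : regular 2 H.
Proof.
move=> x; have -> : [set y | adj H x y] = [set f (g x + 1); f (g x - 1)].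
  apply/setP => y; rewrite !inE H_adj /cycle_adj -!(can2_eq gK fK).
  by congr (_ || _); rewrite [RHS]eq_sym subr_eq.
rewrite cards2 (can_eq fK) -subr_eq0.
rewrite (_ : _ - _ = 2%:R); last by ring.
by rewrite natr_neq0 //; lia.
Qed.

End CycleGraph.

Lemma cycle_adj_sym m : symmetric (@cycle_adj m).
Proof. by move=> x y; rewrite /cycle_adj orbC. Qed.

Lemma cycle_adj_irrefl m : irreflexive (@cycle_adj m).
Proof.
by move=> x; rewrite /cycle_adj orbb eq_sym -subr_eq0 addrC addKr oner_eq0.
Qed.

(** [FH.1] is [G] pulled back along division by [u] followed by [h]; [FH.2] is the standard cycle
    relabelled by [swap e] and then multiplied by [u]. *)
Lemma jump_decomposition m (V : finType) (G : sgraph V) (u : 'I_m.+2) :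
  (4 <= m)%N -> #|V| = m.+2 -> regular 2 G -> u \is a GRing.unit ->
  exists FH : sgraph 'I_m.+2 * sgraph 'I_m.+2,
  [/\ isomorphic FH.1 G, hamilton_cycle FH.2, regular 2 FH.2,
      forall x y, adj FH.1 x y -> jump u (y - x)
    & forall x y, adj FH.2 x y = jump u (y - x) && ~~ adj FH.1 x y].
Proof.
move=> m4 V_card G2 uU.
have [h [e [bh eP hadj]]] := two_regular_cyclic_order V_card G2.
pose k (x : 'I_m.+2) := h (u^-1 * x); pose g x := swap e (u^-1 * x).
pose f x := u * swap e x.
have F_sym : symmetric (fun x y => adj G (k x) (k y)).
  by move=> x y; rewrite adj_sym.
have F_irr : irreflexive (fun x y => adj G (k x) (k y)).
  by move=> x; rewrite adj_irrefl.
have H_sym : symmetric (fun x y => cycle_adj (g x) (g y)).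
  by move=> x y; rewrite cycle_adj_sym.
have H_irr : irreflexive (fun x y => cycle_adj (g x) (g y)).
  by move=> x; rewrite cycle_adj_irrefl.
have fK : cancel f g by move=> x; rewrite /f /g mulKr // swapK.
have gK : cancel g f by move=> x; rewrite /f /g swapK // mulVKr.
exists (SGraph F_sym F_irr, SGraph H_sym H_irr); split=> //=.
- exists k; split=> //; apply: (bij_comp bh).
  by exists ( *%R u) => x; rewrite ?mulVKr ?mulKr.
- by apply: (cycle_adj_hamilton _ fK gK) => //; lia.
- by apply: (cycle_adj_regular _ fK gK) => //; lia.
- by move=> x y; rewrite /k hadj -near_jump //; apply: cyclic_near.
- by move=> x y; rewrite /g cycle_adj_swap_near // near_jump // hadj.
Qed.

Lemma jump_valE m t (d : 'I_m.+2) : (4 * t + 2 < m.+2)%N ->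
  jump (2 * t + 1)%:R d =
  [|| d == 2 * t + 1 :> nat, d == m.+2 - (2 * t + 1) :> nat,
      d == 4 * t + 2 :> nat | d == m.+2 - (4 * t + 2) :> nat]%N.
Proof.
move=> lt_t.
have vE k : (k < m.+2)%N -> (d == k%:R) = (d == k :> nat).
  by move=> lt_k; rewrite -val_eqE /= val_natr modn_small.
have nE k : (0 < k < m.+2)%N -> (d == - k%:R) = (d == m.+2 - k :> nat)%N.
  move=> lt_k; rewrite -val_eqE /= val_natr (@modn_small k); last lia.
  by rewrite modn_small //; lia.
by rewrite /jump !inE -natrD !vE ?nE; lia.
Qed.

Local Close Scope ring_scope.

(** * The odd multipliers below p and the differences they cover *)

Section Multipliers.
Variables p m : nat.
Hypotheses (p_odd : odd p) (pm : 2 * p = m.+2).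
Implicit Types (s t : 'I_((p - 1) %/ 2)) (d : 'I_m.+2).

Definition multiplier t : 'I_m.+2 := ((2 * t + 1)%:R)%R.

(** The number 2t + 1 is odd and less than the prime p, hence coprime to 2p. *)
Lemma multiplier_unit t : prime p -> multiplier t \is a GRing.unit.
Proof.
move=> p_prime; have lt_t := ltn_ord t.
rewrite /multiplier (@unitZpE m.+2) // -pm coprimeMl coprime2n prime_coprime //.
rewrite (_ : odd _); last lia.
by apply/negP => /dvdn_leq; lia.
Qed.

Lemma jump_multiplierE t d : jump (multiplier t) d =
  [|| d == 2 * t + 1 :> nat, d == m.+2 - (2 * t + 1) :> nat,
      d == 4 * t + 2 :> nat | d == m.+2 - (4 * t + 2) :> nat].
Proof. by apply: jump_valE; have := ltn_ord t; lia. Qed.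

(** With u = 2t + 1, parity separates u and 2p - u from 2u and 2p - 2u. The first two lie on
    opposite sides of p; the last two are 2 and 0 modulo 4, as p is odd. *)
Lemma jump_multiplier_inj s t d :
  jump (multiplier s) d -> jump (multiplier t) d -> s = t.
Proof.
have := ltn_ord s; have := ltn_ord t; rewrite !jump_multiplierE => *.
by apply: ord_inj; lia.
Qed.

Lemma jump_multiplier_neq t d : jump (multiplier t) d ->
  (d != 0 :> nat) && (d != p :> nat).
Proof. by have := ltn_ord t; rewrite jump_multiplierE; lia. Qed.

Lemma jump_multiplier_exists d : d != 0 :> nat -> d != p :> nat ->
  exists t, jump (multiplier t) d.
Proof.
have := ltn_ord d => lt_d d0 dp.
have [t lt_t tP] : exists2 t, t < (p - 1) %/ 2 &
  [|| d == 2 * t + 1 :> nat, d == m.+2 - (2 * t + 1) :> nat,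
      d == 4 * t + 2 :> nat | d == m.+2 - (4 * t + 2) :> nat].
  (* Here u = 2t + 1 is d, 2p - d, d/2 or p - d/2, whichever is odd and less than p. *)
  have [d_odd|d_even] := boolP (odd d).
    have [ltp|gep] := ltnP d p; [exists (d %/ 2)|exists ((m.+2 - d) %/ 2)]; lia.
  have [k_odd|k_even] := boolP (odd (d %/ 2)); first by exists (d %/ 4); lia.
  by exists ((p - d %/ 2) %/ 2); lia.
by exists (Ordinal lt_t); rewrite jump_multiplierE.
Qed.

End Multipliers.

(** * Assembly of the 2-factorisation *)

(** The order is a variable [n] so that it can be rewritten as [m.+2], the form that carries the
    ring of residues. *)
Lemma two_factorisation_order_2p p n (p_prime : prime p) (p_odd : odd p)
    (V : 'I_((p - 1) %/ 2) -> finType)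
    (G : forall i : 'I_((p - 1) %/ 2), sgraph (V i))
    (G_order : forall i, #|V i| = 2 * p)
    (G_regular : forall i, regular 2 (G i)) : n = 2 * p ->
  exists (I : sgraph 'I_n) (F : 'I_(p - 1) -> sgraph 'I_n),
    [/\ factor 1 I (K n),
        two_factorisation F (delete_edges (K n) I),
        forall (i : 'I_((p - 1) %/ 2)) (j : 'I_(p - 1)),
          j = i :> nat -> isomorphic (F j) (G i)
      & forall j : 'I_(p - 1), (p - 1) %/ 2 <= j -> hamilton_cycle (F j)].
Proof.
move=> nE; have p_gt1 := prime_gt1 p_prime.
have p3 : 2 < p.
  by case: p p_odd p_gt1 {p_prime V G G_order G_regular nE} => [|[|[]]].
case: n nE => [|[|m]] /esym pm; [lia|lia|].
have m4 : 4 <= m by lia.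
have [FH dec] := fin_all_exists (fun t => jump_decomposition m4
  (etrans (G_order t) pm) (G_regular t)
  (multiplier_unit p_odd pm t p_prime)).
pose P : 'I_m.+2 := (p%:R)%R.
have valP : P = p :> nat by rewrite val_natr modn_small //; lia.
have PE (x y : 'I_m.+2) : (y == x + P)%R = ((y - x)%R == p :> nat).
  by rewrite -valP val_eqE subr_eq addrC.
(* Adding p is an involution modulo 2p, so the matching is symmetric. *)
have NP : (- P = P)%R.
  apply/eqP; rewrite -subr_eq0 -opprD oppr_eq0 -natrD -val_eqE /= val_natr.
  by rewrite addnn -mul2n pm modnn.
have I_sym : symmetric (fun x y : 'I_m.+2 => y == x + P)%R.
  by move=> x y; rewrite eq_sym -subr_eq NP.
have I_irr : irreflexive (fun x y : 'I_m.+2 => y == x + P)%R.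
  by move=> x; rewrite PE subrr /=; lia.
have E : p - 1 = (p - 1) %/ 2 + (p - 1) %/ 2 by lia.
(* Indices t and (p - 1)/2 + t receive the copy of [G t] and the Hamilton cycle with the same
   multiplier. *)
pose F (j : 'I_(p - 1)) :=
  match split (cast_ord E j) with inl t => (FH t).1 | inr t => (FH t).2 end.
have F_lo (j : 'I_(p - 1)) (t : 'I_((p - 1) %/ 2)) :
    j = t :> nat -> F j = (FH t).1.
  rewrite /F => jt; case: splitP => [s /= js|s /= js].
    by rewrite (_ : s = t) //; apply: ord_inj; rewrite -js.
  by have := ltn_ord t; lia.
have F_hi (j : 'I_(p - 1)) (t : 'I_((p - 1) %/ 2)) :
    j = (p - 1) %/ 2 + t :> nat -> F j = (FH t).2.
  rewrite /F => jt; case: splitP => [s /= js|s /= js].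
    by have := ltn_ord s; lia.
  by rewrite (_ : s = t) //; apply: ord_inj; lia.
have F_case (j : 'I_(p - 1)) : exists t : 'I_((p - 1) %/ 2),
    j = t :> nat /\ F j = (FH t).1 \/
    j = (p - 1) %/ 2 + t :> nat /\ F j = (FH t).2.
  by rewrite /F; case: splitP => t /= jt; exists t; [left|right].
have F_jump (j : 'I_(p - 1)) (t : 'I_((p - 1) %/ 2)) x y :
    j = t :> nat \/ j = (p - 1) %/ 2 + t :> nat ->
    adj (F j) x y -> jump (multiplier m t) (y - x)%R.
  have [_ _ _ F1 F2] := dec t.
  by case=> [/F_lo->|/F_hi->]; [apply: F1|rewrite F2 => /andP[]].
exists (SGraph I_sym I_irr), F; split.
- split=> [x y /= /eqP->|x].
    by apply/negP => /eqP xE; have := I_irr x; rewrite -xE eqxx.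
  rewrite (_ : [set _ | _] = [set x + P]%R) ?cards1 //.
  by apply/setP => y; rewrite !inE.
- split.
  + move=> j; have [t jt] := F_case j; have [iso ham reg F1 F2] := dec t; split.
      move=> x y Fxy; have dt : jump (multiplier m t) (y - x)%R.
        by apply: F_jump Fxy; tauto.
      have /andP[d0 dp] := jump_multiplier_neq p_odd pm dt.
      rewrite /= PE dp andbT.
      by apply: contraNneq d0 => ->; rewrite subrr.
    by case: jt => [[_ ->]|[_ ->]] //; apply: isomorphic_regular iso _.
  + move=> i j x y Fi Fj; have [s iS] := F_case i; have [t jt] := F_case j.
    have ds : jump (multiplier m s) (y - x)%R by apply: F_jump Fi; tauto.
    have dt : jump (multiplier m t) (y - x)%R by apply: F_jump Fj; tauto.
    (* The difference along a common edge determines the multiplier, and the two factors of one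
       multiplier are disjoint. *)
    have st := jump_multiplier_inj p_odd pm ds dt; rewrite -st {t dt st} in jt.
    have [_ _ _ F1 F2] := dec s.
    case: iS jt Fi Fj => [[iS ->]|[iS ->]] [[jt ->]|[jt ->]]; rewrite ?F2;
      try by move=> *; apply: ord_inj; rewrite iS jt.
      by move=> -> /=; rewrite andbF.
    by move=> /andP[_ /negPf->].
  + move=> x y /= /andP[xy]; rewrite PE => dp.
    have d0 : (y - x)%R != 0 :> nat.
      apply: contraNneq xy => d0; rewrite eq_sym -subr_eq0.
      by apply/eqP/ord_inj.
    have [t dt] := jump_multiplier_exists p_odd pm d0 dp.
    have [_ _ _ F1 F2] := dec t.
    have lt_t := ltn_ord t.
    have lo : t < p - 1 by lia.
    have hi : (p - 1) %/ 2 + t < p - 1 by lia.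
    have [Fxy|nFxy] := boolP (adj (FH t).1 x y).
      by exists (Ordinal lo); rewrite (F_lo _ t).
    by exists (Ordinal hi); rewrite (F_hi _ t) // F2 dt.
- by move=> i j /F_lo->; case: (dec i).
- move=> j le_j; have [t [[jt _]|[_ ->]]] := F_case j; last by case: (dec t).
  by have := ltn_ord t; lia.
Qed.

Theorem theorem29 (p : nat) (p_prime : prime p) (p_odd : odd p)
    (V : 'I_((p - 1) %/ 2) -> finType)
    (G : forall i : 'I_((p - 1) %/ 2), sgraph (V i))
    (G_order : forall i, #|V i| = 2 * p)
    (G_regular : forall i, regular 2 (G i)) :
  exists (I : sgraph 'I_(2 * p)) (F : 'I_(p - 1) -> sgraph 'I_(2 * p)),
    [/\ factor 1 I (K (2 * p)),
        two_factorisation F (delete_edges (K (2 * p)) I),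
        forall (i : 'I_((p - 1) %/ 2)) (j : 'I_(p - 1)),
          j = i :> nat -> isomorphic (F j) (G i)
      & forall j : 'I_(p - 1), (p - 1) %/ 2 <= j -> hamilton_cycle (F j)].
Proof.
exact: two_factorisation_order_2p.
Qed.
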